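(* The reduced input matrix $\tilde{\mathbf{B}}(\mathbf{q})$ is invertible for every configuration $\mathbf{q}=[x\ y\ \theta\ \varphi\ \delta_f\ \delta_r]^{\mathrm T}\in\mathbb{R}^6$.
   Context: Parameters $r,a,b>0$ and $A=\frac{a}{2(a^2+b^2)}$. $\tilde{\mathbf{B}}(\mathbf{q})=\mathbf{J}^{\mathrm T}(\mathbf{q})\mathbf{B}(\mathbf{q})\in\mathbb{R}^{3\times3}$, where $\mathbf{J}(\mathbf{q})\in\mathbb{R}^{6\times3}$ has first column $$\big[\tfrac12(\cos(\delta_f+\theta)+\cos(\delta_r+\theta)),\ \tfrac12(\sin(\delta_f+\theta)+\sin(\delta_r+\theta)),\ A(\sin\delta_f-\sin\delta_r),\ r^{-1},\ 0,\ 0\big]^{\mathrm T}$$ and second and third columns $e_5,e_6$ (standard basis of $\mathbb{R}^6$), and $\mathbf{B}(\mathbf{q})\in\mathbb{R}^{6\times3}$ has first column $$\big[\tfrac2r(\cos(\delta_f+\theta)+\cos(\delta_r+\theta)),\ \tfrac2r(\sin(\delta_f+\theta)+\sin(\delta_r+\theta)),\ \tfrac{2a}{r}(\sin\delta_f-\sin\delta_r),\ 4,\ 0,\ 0\big]^{\mathrm T}$$ and second and third columns $2e_5,2e_6$. Explicitly, $\tilde{\mathbf{B}}(\mathbf{q})=\mathrm{diag}(\tilde B_{11},2,2)$ with $\tilde B_{11}=\frac1r\big[2(1+\cos(\delta_f-\delta_r))+\frac{a^2}{a^2+b^2}(\sin\delta_f-\sin\delta_r)^2+4\big]$. *)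

(* Defs.v *)
From HB Require Import structures.
From mathcomp Require Import all_boot all_order all_algebra.
From mathcomp Require Import all_classical all_reals all_analysis.

Set Implicit Arguments.
Unset Strict Implicit.
Unset Printing Implicit Defensive.

Import Order.TTheory GRing.Theory Num.Theory.

Local Open Scope ring_scope.

Section ReducedInputMatrix.
Variable R : realType.

(* A configuration is q = [x y theta phi delta_f delta_r]^T; of its six
   coordinates only theta, delta_f and delta_r enter the matrices below. *)
Definition theta (q : 'cV[R]_6) : R := q (@Ordinal 6 2 isT) 0.
Definition delta_f (q : 'cV[R]_6) : R := q (@Ordinal 6 4 isT) 0.
Definition delta_r (q : 'cV[R]_6) : R := q (@Ordinal 6 5 isT) 0.

(* The vectors e_5 and e_6 are 1-based in the mathematical notation. *)
Definition e5 : 'cV[R]_6 := delta_mx (@Ordinal 6 4 isT) 0.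
Definition e6 : 'cV[R]_6 := delta_mx (@Ordinal 6 5 isT) 0.

Definition coefA (a b : R) : R := a / (2 * (a ^+ 2 + b ^+ 2)).

Definition J_col1 (r a b : R) (q : 'cV[R]_6) : 'cV[R]_6 :=
  \col_(i < 6)
    [:: 2^-1 * (cos (delta_f q + theta q) + cos (delta_r q + theta q));
        2^-1 * (sin (delta_f q + theta q) + sin (delta_r q + theta q));
        coefA a b * (sin (delta_f q) - sin (delta_r q));
        r^-1;
        0;
        0]`_i.

Definition B_col1 (r a : R) (q : 'cV[R]_6) : 'cV[R]_6 :=
  \col_(i < 6)
    [:: 2 / r * (cos (delta_f q + theta q) + cos (delta_r q + theta q));
        2 / r * (sin (delta_f q + theta q) + sin (delta_r q + theta q));
        2 * a / r * (sin (delta_f q) - sin (delta_r q));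
        4;
        0;
        0]`_i.

Definition Jmat (r a b : R) (q : 'cV[R]_6) : 'M[R]_(6, 3) :=
  \matrix_(i < 6, j < 3) [:: J_col1 r a b q; e5; e6]`_j i 0.

Definition Bmat (r a : R) (q : 'cV[R]_6) : 'M[R]_(6, 3) :=
  \matrix_(i < 6, j < 3) [:: B_col1 r a q; 2 *: e5; 2 *: e6]`_j i 0.

Definition Btilde (r a b : R) (q : 'cV[R]_6) : 'M[R]_3 :=
  (Jmat r a b q)^T *m Bmat r a q.

End ReducedInputMatrix.

(* Main.v *)
(** Each of the first four entries of the first column of B is a positive
    multiple of the corresponding entry of J, and the fourth contributes
    4 / r > 0; the other columns only involve e_5 and e_6, so J^T B is diagonal
    with positive diagonal entries. *)

Require Import Defs.
From mathcomp Require Import all_boot all_order all_algebra.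
From mathcomp Require Import all_classical all_reals all_analysis.
From mathcomp Require Import ring.
Import Order.TTheory GRing.Theory Num.Theory.
Local Open Scope ring_scope.

(** The paper's entry, with [2 * (1 + cos (delta_f - delta_r))] left as the sum
    of the two squares it comes from. *)
Definition Btilde11 {R : realType} (r a b : R) (q : 'cV[R]_6) : R :=
  r^-1 * ((cos (delta_f q + theta q) + cos (delta_r q + theta q)) ^+ 2
          + (sin (delta_f q + theta q) + sin (delta_r q + theta q)) ^+ 2
          + a ^+ 2 / (a ^+ 2 + b ^+ 2) * (sin (delta_f q) - sin (delta_r q)) ^+ 2
          + 4).

Lemma Btilde11_gt0 (R : realType) (r a b : R) (q : 'cV[R]_6) :
  0 < r -> 0 < Btilde11 r a b q.
Proof.
(* The summand 4 alone gives strictness; the weighted squares before it need only be nonnegative. *)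
move=> hr; rewrite /Btilde11 mulr_gt0 ?invr_gt0 // ltr_wpDl ?ltr0n //.
by do ?[exact: sqr_ge0 | rewrite invr_ge0 | apply: addr_ge0 | apply: mulr_ge0].
Qed.

Lemma Btilde_diag (R : realType) (r a b : R) (q : 'cV[R]_6) :
  r != 0 -> a ^+ 2 + b ^+ 2 != 0 ->
  Btilde r a b q = diag_mx (\row_(j < 3) [:: Btilde11 r a b q; 2; 2]`_j).
Proof.
move=> r0 ab0; apply/matrixP => -[[|[|[|//]]] hi] [[|[|[|//]]] hj];
  rewrite !mxE !big_ord_recl big_ord0 !mxE /= ?mxE /= ?mulr0n ?mulr1n;
  rewrite ?(mulr0, mul0r, mulr1, mul1r, addr0, add0r) //.
(* Only the top-left entry is left: [2^-1 * (2 / r)] is [r^-1], and [coefA a b * (2 * a / r)] is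
   [r^-1] times the weight [a ^+ 2 / (a ^+ 2 + b ^+ 2)]. *)
by rewrite /Btilde11 /coefA; field; rewrite ab0.
Qed.

Theorem mainTheorem7 (R : realType) (r a b : R)
    (hr : 0 < r) (ha : 0 < a) (hb : 0 < b) (q : 'cV[R]_6) :
  Btilde r a b q \in unitmx.
Proof.
have ab0 : a ^+ 2 + b ^+ 2 != 0 by rewrite gt_eqF // addr_gt0 ?exprn_gt0.
have r0 : r != 0 by rewrite gt_eqF.
(* Over a field, invertibility means a nonzero determinant, here the product of the three positive
   diagonal entries. *)
rewrite Btilde_diag // unitmxE det_diag unitfE.
rewrite !big_ord_recl big_ord0 !mxE /= mulr1.
by rewrite gt_eqF // mulr_gt0 ?Btilde11_gt0 // mulr_gt0.
Qed.
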